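(* Let $\nu$ be the uniform probability distribution on $[0,1]$, and for $j\in\mathbb{N}$ let $C_j=\{(x,y)\in\mathbb{R}^2 : -\frac1j\le x\le 1,\ y=x+\frac1j\}$. Then, for every $n\in\mathbb{N}$, a constrained optimal set of $n$-points for $\nu$ with respect to the family $\{C_j : j\in\mathbb{N}\}$ is given by $$\left\{\Big(\tfrac{1}{2}\big(\tfrac{2j-1}{2n}-\tfrac{1}{n}\big),\ \tfrac{1}{2}\big(\tfrac{2j-1}{2n}-\tfrac{1}{n}\big)+\tfrac{1}{n}\Big) : 1\le j\le n\right\},$$ with $n$th constrained quantization error $$R_n=\frac{4n^2+12n+13}{24n^2}.$$
   Context: A real number $x$ is identified with $(x,0)\in\mathbb{R}^2$, so $\nu$ is regarded as a Borel probability measure on $\mathbb{R}^2$ supported on $[0,1]\times\{0\}$; $d$ denotes Euclidean distance on $\mathbb{R}^2$. The $n$th constrained quantization error of $\nu$ with respect to $\{C_j\}$ is $$R_n=R_n(\nu)=\inf\Big\{\int \min_{a\in\gamma} d(x,a)^2\,d\nu(x) : \gamma\subseteq\bigcup_{j=1}^n C_j,\ 1\le \mathrm{card}(\gamma)\le n\Big\}.$$ A constrained optimal set of $n$-points for $\nu$ is a set $\gamma\subseteq\bigcup_{j=1}^n C_j$ with $1\le\mathrm{card}(\gamma)\le n$ for which this infimum is attained. *)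

(* Defs.v *)
From HB Require Import structures.
From mathcomp Require Import all_boot all_order all_algebra finmap.
From mathcomp Require Import all_classical all_reals all_analysis.

Set Implicit Arguments.
Unset Strict Implicit.
Unset Printing Implicit Defensive.

Import Order.TTheory GRing.Theory Num.Theory.

Local Open Scope classical_set_scope.
Local Open Scope ring_scope.

(* The product sigma-algebra carried by this type is the Borel sigma-algebra
   of the plane. *)
Notation plane R := (measurableTypeR R * measurableTypeR R)%type.

(* The library norm on a product is the maximum norm, hence an explicit
   Euclidean distance. *)
Definition euclidean_dist (R : realType) (p q : plane R) : R :=
  Num.sqrt ((p.1 - q.1) ^+ 2 + (p.2 - q.2) ^+ 2).

Section constrained_quantization.
Context {R : realType}.
Implicit Types (nu : probability (plane R) R) (C : nat -> set (plane R)).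

(* +oo is only the neutral element of min: it is never attained when gamma is
   nonempty. *)
Definition distortion nu (gamma : {fset plane R}) : \bar R :=
  (\int[nu]_p
     \big[Order.min/+oo]_(a <- gamma) (euclidean_dist p a ^+ 2)%:E)%E.

(* The families are indexed by the positive integers; C 0 is never used. *)
Definition admissible C (n : nat) (gamma : {fset plane R}) : Prop :=
  [set` gamma] `<=` \bigcup_(j in [set j | (1 <= j <= n)%N]) C j
  /\ (1 <= #|` gamma| <= n)%N.

Definition constrained_quantization_error nu C (n : nat) : \bar R :=
  ereal_inf [set distortion nu gamma | gamma in admissible C n].

Definition constrained_optimal_set nu C (n : nat) (gamma : {fset plane R}) :
    Prop :=
  admissible C n gamma
  /\ distortion nu gamma = constrained_quantization_error nu C n.

End constrained_quantization.

Section uniform_on_segment.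
Context (R : realType).

Definition real_to_plane (x : measurableTypeR R) : plane R := (x, 0).

Let measurable_real_to_plane : measurable_fun setT real_to_plane.
Proof. exact: measurable_fun_pair. Qed.

HB.instance Definition _ :=
  isMeasurableFun.Build _ _ _ _ real_to_plane measurable_real_to_plane.

Definition uniform01_plane : probability (plane R) R :=
  distribution (uniform_prob (@ltr01 R)) real_to_plane.

Definition diagonal_segment (j : nat) : set (plane R) :=
  [set p : plane R | - (j%:R^-1 : R) <= p.1 <= 1
                     /\ p.2 = p.1 + j%:R^-1 :> R].

Definition optimal_point (n j : nat) : plane R :=
  let x : R := 2^-1 * ((2 * j%:R - 1) / (2 * n%:R) - n%:R^-1) in
  (x, x + n%:R^-1).

Definition optimal_points (n : nat) : {fset plane R} :=
  [fset optimal_point n j | j in iota 1 n]%fset.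

End uniform_on_segment.

(* Main.v *)
(* For a point [a] of [C_j], lying on the line [y = x + t] with [t = 1/j], and
   [u = a.1 + a.2], the squared distance from [(x, 0)] to [a] is
   [((x + t)^2 + (x - u)^2) / 2].  Hence the smallest offset [t = 1/n] is the
   best one, and what remains is the classical quantization of the uniform
   distribution by the positions [u].
   With [r = 1/(2n)], the minimum of [(x - u)^2] over at most [n] positions is
   at least [r^2] minus the sum of the caps [max 0 (r^2 - (x - u)^2)], each of
   integral at most [4 r^3 / 3]; integrating gives the lower bound.  Equality
   holds throughout when the intervals [[u - r, u + r]] tile [[0, 1]]. *)
Require Import Defs.
From HB Require Import structures.
From mathcomp Require Import all_boot all_order all_algebra finmap.
From mathcomp Require Import all_classical all_reals all_analysis.
From mathcomp Require Import measurable_realfun ring lra.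

Import Order.TTheory GRing.Theory Num.Theory.
Import numFieldNormedType.Exports.

Local Open Scope classical_set_scope.
Local Open Scope ring_scope.


(** With a polynomial antiderivative the regularity conditions of the fundamental theorem are
    automatic, so each explicit integral below only needs a suitable [p]. *)
Lemma integral_deriv_horner (R : realType) (p : {poly R}) (a b : R) : a < b ->
  (\int[lebesgue_measure]_(x in `[a, b]) (p^`().[x])%:E = (p.[b] - p.[a])%:E)%E.
Proof.
move=> ab; rewrite (@continuous_FTC2 _ _ (horner p)) ?EFinB//.
- by apply: continuous_subspaceT => x; exact: continuous_horner.
- split=> [x _| |].
  + exact: derivable_horner.
  + by apply: cvg_at_right_filter; exact: continuous_horner.
  + by apply: cvg_at_left_filter; exact: continuous_horner.
- by move=> x _; rewrite derive1E; exact: derive_val.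
Qed.

(** * Parabolic caps and their integrals *)

Definition parabolic_hat {R : realType} (r u x : R) : R :=
  Num.max 0 (r ^+ 2 - (x - u) ^+ 2).

Section parabolic_hat.
Context {R : realType}.
Implicit Types r u x : R.

Lemma parabolic_hat_ge0 r u x : 0 <= parabolic_hat r u x.
Proof. by rewrite /parabolic_hat le_max lexx. Qed.

Lemma ge_parabolic_hat r u x : r ^+ 2 - (x - u) ^+ 2 <= parabolic_hat r u x.
Proof. by rewrite /parabolic_hat le_max lexx orbT. Qed.

Lemma parabolic_hat_in r u x : `|x - u| <= r ->
  parabolic_hat r u x = r ^+ 2 - (x - u) ^+ 2.
Proof.
rewrite ler_norml => /andP[h1 h2]; rewrite /parabolic_hat max_r//; nra.
Qed.

Lemma parabolic_hat_out r u x : 0 <= r -> r <= `|x - u| ->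
  parabolic_hat r u x = 0.
Proof.
move=> r0 rx; rewrite /parabolic_hat max_l// subr_le0.
by rewrite -[leRHS]real_normK ?num_real// lerXn2r// nnegrE.
Qed.

Lemma measurable_parabolic_hat r u : measurable_fun setT (parabolic_hat r u).
Proof.
apply: measurable_maxr => //; apply: measurable_funB => //.
by apply: measurable_funX; apply: measurable_funB.
Qed.

Lemma integral_parabolic_hat_support r u : 0 < r ->
  (\int[lebesgue_measure]_(x in `[(u - r)%R, (u + r)%R])
     (parabolic_hat r u x)%:E
   = (4 / 3 * r ^+ 3)%:E)%E.
Proof.
move=> r0.
pose p : {poly R} := (r ^+ 2) *: 'X - 3^-1 *: ('X - u%:P) ^+ 3.
have dp x : p^`().[x] = r ^+ 2 - (x - u) ^+ 2.
  rewrite /p derivB !derivZ derivX deriv_exp derivXsubC.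
  by rewrite !hornerE/=; field.
transitivity
  (\int[lebesgue_measure]_(x in `[(u - r)%R, (u + r)%R]) (p^`().[x])%:E)%E.
  apply: eq_integral => x; rewrite inE/= in_itv/= => /andP[h1 h2].
  by rewrite dp parabolic_hat_in// ler_norml; apply/andP; split; lra.
have ab : u - r < u + r by lra.
rewrite integral_deriv_horner//.
by congr EFin; rewrite /p !hornerE/=; field.
Qed.

(** The cap vanishes outside [[u - r, u + r]]. This reduces both integrals below to the support: a
    cap sticking out of [A] loses mass, one inside [A] keeps all of it. *)
Lemma integral_parabolic_hat_restr (A : set R) r u : 0 <= r ->
  (\int[lebesgue_measure]_(x in A) (parabolic_hat r u x)%:E =
   \int[lebesgue_measure]_(x in A `&` `[(u - r)%R, (u + r)%R])
     (parabolic_hat r u x)%:E)%E.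
Proof.
move=> r0; rewrite integral_mkcondr; apply: eq_integral => x _.
rewrite patchE; case: ifPn => //; rewrite notin_setE/= in_itv/= => /negP xI.
rewrite parabolic_hat_out// leNgt; apply: contra xI => /ltW.
by rewrite ler_norml => /andP[h1 h2]; apply/andP; split; lra.
Qed.

Lemma integral_parabolic_hat_le (A : set (measurableTypeR R)) r u :
  measurable A -> 0 < r ->
  (\int[lebesgue_measure]_(x in A) (parabolic_hat r u x)%:E
   <= (4 / 3 * r ^+ 3)%:E)%E.
Proof.
move=> mA r0; rewrite (integral_parabolic_hat_restr _ _ _ (ltW r0)).
rewrite -(integral_parabolic_hat_support r u)//.
apply: ge0_subset_integral => //.
- exact: measurableI.
- apply/measurable_EFinP/measurable_funTS; exact: measurable_parabolic_hat.
- by move=> x _; rewrite lee_fin parabolic_hat_ge0.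
Qed.

Lemma integral_parabolic_hat (A : set R) r u : 0 < r ->
  `[u - r, u + r] `<=` A ->
  (\int[lebesgue_measure]_(x in A) (parabolic_hat r u x)%:E
   = (4 / 3 * r ^+ 3)%:E)%E.
Proof.
move=> r0 IA; rewrite (integral_parabolic_hat_restr _ _ _ (ltW r0)) setIidr//.
exact: integral_parabolic_hat_support.
Qed.

End parabolic_hat.

(** * The distortion as an integral over the unit interval *)

Section distortion.
Context {R : realType}.
Implicit Types (gamma : {fset plane R}) (a p : plane R) (x : R).

Lemma sqr_euclidean_dist p a :
  euclidean_dist p a ^+ 2 = (p.1 - a.1) ^+ 2 + (p.2 - a.2) ^+ 2.
Proof. by rewrite /euclidean_dist sqr_sqrtr// addr_ge0// sqr_ge0. Qed.

(* Rotating by 45 degrees separates the position of [a] along the diagonal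
   lines, [a.1 + a.2], from its offset [a.2 - a.1]. *)
Lemma sqr_euclidean_dist_axis x a :
  euclidean_dist (real_to_plane x) a ^+ 2 =
  ((x + (a.2 - a.1)) ^+ 2 + (x - (a.1 + a.2)) ^+ 2) / 2.
Proof. by rewrite sqr_euclidean_dist/=; field. Qed.

Lemma measurable_bigmin_sqr_dist (s : seq (plane R)) :
  measurable_fun setT (fun p : plane R =>
    \big[Order.min/+oo%E]_(a <- s) (euclidean_dist p a ^+ 2)%:E).
Proof.
elim: s => [|a s ih].
  by under eq_fun do rewrite big_nil; exact: measurable_cst.
under eq_fun do rewrite big_cons.
apply: measurable_mine => //; apply/measurable_EFinP.
under eq_fun do rewrite sqr_euclidean_dist.
by apply: measurable_funD; apply: measurable_funX; apply: measurable_funB => //.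
Qed.

Lemma measurable_bigmin_sqr_dist_axis (A : set (measurableTypeR R))
    (s : seq (plane R)) :
  measurable_fun A (fun x : measurableTypeR R =>
    \big[Order.min/+oo%E]_(a <- s)
       (euclidean_dist (real_to_plane x) a ^+ 2)%:E).
Proof.
apply: measurable_funTS.
exact: (measurableT_comp (measurable_bigmin_sqr_dist s)
         (measurable_funPT (@real_to_plane R))).
Qed.

Lemma bigmin_sqr_dist_ge0 (s : seq (plane R)) p :
  (0 <= \big[Order.min/+oo]_(a <- s) (euclidean_dist p a ^+ 2)%:E)%E.
Proof.
elim: s => [|a s ih]; first by rewrite big_nil.
by rewrite big_cons le_min ih lee_fin sqr_ge0.
Qed.

(** Change of variables along the embedding of the line, then the density of the uniform law, which
    is 1 on the interval. *)
Lemma distortion_uniform01 gamma :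
  distortion (uniform01_plane R) gamma =
  (\int[lebesgue_measure]_(x in `[0%R, 1%R])
     \big[Order.min/+oo]_(a <- gamma)
        (euclidean_dist (real_to_plane x) a ^+ 2)%:E)%E.
Proof.
rewrite /distortion ge0_integral_distribution; first last.
- by move=> p; exact: bigmin_sqr_dist_ge0.
- exact: measurable_bigmin_sqr_dist.
rewrite integral_uniform; first last.
- by move=> x; exact: bigmin_sqr_dist_ge0.
- exact: measurable_bigmin_sqr_dist_axis.
by rewrite subr0 invr1 mul1e.
Qed.

End distortion.

(** * Lower and upper bounds for the distortion *)

Section optimality.
Context {R : realType}.
Implicit Types (gamma : {fset plane R}) (a : plane R) (x r s : R).

(** The cap is halved to match the factor 1/2 in [sqr_euclidean_dist_axis]. For a point of offset
    [s] whose position is within [r] of [x], squared distance plus [hat] is exactly [profile],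
    whatever the position. *)
Let hat r a x : R := parabolic_hat r (a.1 + a.2) x / 2.
Let profile r s x : R := ((x + s) ^+ 2 + r ^+ 2) / 2.

Let hat_ge0 r a x : 0 <= hat r a x.
Proof. by rewrite divr_ge0// parabolic_hat_ge0. Qed.

Let measurable_hat r a : measurable_fun setT (fun x => (hat r a x)%:E).
Proof.
apply/measurable_EFinP/measurable_funM => //.
exact: measurable_parabolic_hat.
Qed.

Let integral_profile r s :
  (\int[lebesgue_measure]_(x in `[0%R, 1%R]) (profile r s x)%:E
   = (((1 + s) ^+ 3 - s ^+ 3) / 6 + r ^+ 2 / 2)%:E)%E.
Proof.
pose p : {poly R} := 6^-1 *: ('X + s%:P) ^+ 3 + (r ^+ 2 / 2) *: 'X.
have dp x : profile r s x = p^`().[x].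
  rewrite /p derivD !derivZ derivX deriv_exp derivD derivX derivC.
  by rewrite !hornerE/= /profile; field.
under eq_integral do rewrite dp.
rewrite integral_deriv_horner//.
by congr EFin; rewrite /p !hornerE/=; field.
Qed.

Let integral_hat (A : set (measurableTypeR R)) r a : measurable A ->
  (\int[lebesgue_measure]_(x in A) (hat r a x)%:E =
   2^-1%:E * \int[lebesgue_measure]_(x in A)
     (parabolic_hat r (a.1 + a.2) x)%:E)%E.
Proof.
move=> mA; under eq_integral do rewrite /hat mulrC EFinM.
rewrite ge0_integralZl//.
- apply/measurable_EFinP/measurable_funTS; exact: measurable_parabolic_hat.
- by move=> x _; rewrite lee_fin parabolic_hat_ge0.
Qed.

Let sum_cst_fset gamma (c : R) :
  (\sum_(a <- gamma) c%:E = (#|` gamma|%:R * c)%:E)%E.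
Proof. by rewrite sumEFin big_const_seq count_predT iter_addr_0 mulr_natl. Qed.

(** Both bounds integrate a pointwise comparison of [profile] with this integrand and read off the
    distortion from the identity. *)
Let integral_distortion_hat gamma r :
  (\int[lebesgue_measure]_(x in `[0%R, 1%R])
     (\big[Order.min/+oo]_(a <- gamma)
        (euclidean_dist (real_to_plane x) a ^+ 2)%:E
      + \sum_(a <- gamma) (hat r a x)%:E)
   = distortion (uniform01_plane R) gamma
   + \sum_(a <- gamma)
       \int[lebesgue_measure]_(x in `[0%R, 1%R]) (hat r a x)%:E)%E.
Proof.
rewrite ge0_integralD//=.
- rewrite distortion_uniform01 ge0_integral_sum//.
  + by move=> a; apply/measurable_funTS; exact: measurable_hat.
  + by move=> a x _; rewrite lee_fin.
- by move=> x _; exact: bigmin_sqr_dist_ge0.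
- exact: measurable_bigmin_sqr_dist_axis.
- by move=> x _; apply: sume_ge0 => a _; rewrite lee_fin.
- apply: emeasurable_sum => a; apply/measurable_funTS; exact: measurable_hat.
Qed.

(** The cap of a nearest point alone lifts [(x - u)^2] to at least [r^2], the other caps are
    nonnegative, and since [x] and [s] are nonnegative a larger offset only increases
    [(x + s)^2]. *)
Lemma profile_le_bigmin gamma r s x :
  (forall a, a \in gamma -> s <= a.2 - a.1) -> 0 <= s -> 0 <= x ->
  ((profile r s x)%:E <=
   \big[Order.min/+oo]_(a <- gamma) (euclidean_dist (real_to_plane x) a ^+ 2)%:E
   + \sum_(a <- gamma) (hat r a x)%:E)%E.
Proof.
move=> hs s0 x0.
have {hs}: {in enum_fset gamma, forall a, s <= a.2 - a.1} by [].
elim: (enum_fset gamma) => [|a l ih] hs.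
  (* The empty minimum is [+oo], so the base case is trivial. *)
  by rewrite !big_nil adde0 leey.
have {}ih := ih (sub_in1 (@mem_behead _ (a :: l)) hs).
rewrite !big_cons; set m := bigop _ _ _ in ih *.
set S := bigop _ _ _ in ih *.
have S0 : (0 <= S)%E by apply: sume_ge0 => b _; rewrite lee_fin.
(* If the tail attains the minimum, induction applies and the extra cap is dropped; otherwise the
   head and its own cap suffice. *)
rewrite /Order.min; case: ifP => _; last first.
  by apply: (le_trans ih); rewrite leeD2l// leeDr// lee_fin.
rewrite addeA; apply: (@le_trans _ _
  ((euclidean_dist (real_to_plane x) a ^+ 2)%:E + (hat r a x)%:E)%E);
  last by rewrite leeDl.
rewrite -EFinD lee_fin sqr_euclidean_dist_axis /profile /hat.
have /= := hs a (mem_head _ _); have := ge_parabolic_hat r (a.1 + a.2) x.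
nra.
Qed.

Lemma distortion_ge gamma r s : 0 < r -> 0 <= s ->
  (forall a, a \in gamma -> s <= a.2 - a.1) ->
  ((((1 + s) ^+ 3 - s ^+ 3) / 6 + r ^+ 2 / 2
    - #|` gamma|%:R * (2 / 3 * r ^+ 3))%:E
   <= distortion (uniform01_plane R) gamma)%E.
Proof.
move=> r0 s0 hs; rewrite EFinB leeBlDr// -(integral_profile r s).
apply: (@le_trans _ _ (distortion (uniform01_plane R) gamma
   + \sum_(a <- gamma)
       \int[lebesgue_measure]_(x in `[0%R, 1%R]) (hat r a x)%:E)%E).
  rewrite -integral_distortion_hat; apply: ge0_le_integral => //.
  - by move=> x _; rewrite lee_fin divr_ge0// addr_ge0// sqr_ge0.
  - apply/measurable_EFinP; apply: measurable_funM => //.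
    apply: measurable_funD => //; apply: measurable_funX.
    exact: measurable_funD.
  - apply: emeasurable_funD.
    + exact: measurable_bigmin_sqr_dist_axis.
    + apply: emeasurable_sum => a; apply/measurable_funTS.
      exact: measurable_hat.
  - move=> x /=; rewrite in_itv/= => /andP[x0 _].
    exact: profile_le_bigmin.
rewrite leeD2l//.
apply: (@le_trans _ _ (\sum_(a <- gamma) (2 / 3 * r ^+ 3)%:E)%E).
  apply: lee_sum => a _; rewrite integral_hat//.
  rewrite (_ : 2 / 3 * _ = 2^-1 * (4 / 3 * r ^+ 3)); last by field.
  by rewrite EFinM lee_pmul2l// integral_parabolic_hat_le.
by rewrite sum_cst_fset.
Qed.

(** The hypotheses say that the intervals of radius [r] around the positions tile the unit interval,
    so no cap loses mass and no two caps overlap. *)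
Lemma distortion_le gamma r s : 0 < r ->
  (forall a, a \in gamma -> a.2 - a.1 = s) ->
  (forall a, a \in gamma -> r <= a.1 + a.2 <= 1 - r) ->
  (forall a b, a \in gamma -> b \in gamma -> a != b ->
     2 * r <= `|(a.1 + a.2) - (b.1 + b.2)|) ->
  (forall x, 0 <= x <= 1 -> exists2 a, a \in gamma & `|x - (a.1 + a.2)| <= r) ->
  (distortion (uniform01_plane R) gamma <=
   (((1 + s) ^+ 3 - s ^+ 3) / 6 + r ^+ 2 / 2
    - #|` gamma|%:R * (2 / 3 * r ^+ 3))%:E)%E.
Proof.
move=> r0 hs hin hsep hcov; rewrite EFinB leeBrDr// -(integral_profile r s).
have -> : (#|` gamma|%:R * (2 / 3 * r ^+ 3))%:E =
  (\sum_(a <- gamma)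
       \int[lebesgue_measure]_(x in `[0%R, 1%R]) (hat r a x)%:E)%E.
  rewrite (eq_big_seq (fun=> (2 / 3 * r ^+ 3)%:E)).
    by rewrite sum_cst_fset.
  move=> a /hin /andP[h1 h2]; rewrite integral_hat// integral_parabolic_hat//.
    by rewrite -EFinM; congr EFin; field.
  by move=> x /=; rewrite !in_itv/= => /andP[h3 h4]; apply/andP; split; lra.
rewrite -integral_distortion_hat; apply: ge0_le_integral => //.
- move=> x _; apply: adde_ge0; first exact: bigmin_sqr_dist_ge0.
  by apply: sume_ge0 => a _; rewrite lee_fin.
- apply: emeasurable_funD.
  + exact: measurable_bigmin_sqr_dist_axis.
  + apply: emeasurable_sum => a; apply/measurable_funTS.
    exact: measurable_hat.
- apply/measurable_EFinP; apply: measurable_funM => //.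
  apply: measurable_funD => //; apply: measurable_funX.
  exact: measurable_funD.
move=> x /=; rewrite in_itv/= => /hcov[a ag xa].
(* Positions are [2 * r] apart and [x] is within [r] of that of [a], so [x] is at least [r] away
   from all others and their caps vanish there. *)
have -> : (\sum_(b <- gamma) (hat r b x)%:E = (hat r a x)%:E)%E.
  rewrite (bigD1_seq a)//= big1_seq ?adde0// => b /andP[ba bg]; congr EFin.
  rewrite /hat (parabolic_hat_out _ _ _ (ltW r0)) ?mul0r//.
  move: (hsep _ _ bg ag ba) xa; move: (a.1 + a.2) (b.1 + b.2) => u v.
  by move=> vu xu; have := ler_distD x v u; rewrite (distrC v x); lra.
apply: (@le_trans _ _
  ((euclidean_dist (real_to_plane x) a ^+ 2)%:E + (hat r a x)%:E)%E).
  by rewrite leeD2r// ge_bigmin_seq.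
rewrite -EFinD lee_fin sqr_euclidean_dist_axis /hat parabolic_hat_in// hs//.
by rewrite /profile; lra.
Qed.

End optimality.

(** * Cell midpoints placed on [C_n] *)

Theorem theorem3p5 (R : realType) (n : nat) (n_gt0 : (0 < n)%N) :
  constrained_optimal_set (uniform01_plane R) (@diagonal_segment R) n
    (optimal_points R n)
  /\ constrained_quantization_error (uniform01_plane R) (@diagonal_segment R) n
     = ((4 * n%:R ^+ 2 + 12 * n%:R + 13) / (24 * n%:R ^+ 2))%:E.
Proof.
(* [r] is half the length of one of [n] equal cells; it also maximizes [r^2 / 2 - 2 n r^3 / 3], the
   part of the lower bound depending on [r]. *)
pose r : R := (2 * n%:R)^-1; pose s : R := n%:R^-1.
have N0 : 0 < n%:R :> R by rewrite ltr0n.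
have r0 : 0 < r by rewrite invr_gt0 mulr_gt0.
have s0 : 0 < s by rewrite invr_gt0.
have sr : s = 2 * r by rewrite /s /r; field; lra.
have nr : n%:R * r = 2^-1 by rewrite /r; field; lra.
set V : \bar R := (X in _ = X).
have VE : V = (((1 + s) ^+ 3 - s ^+ 3) / 6 + r ^+ 2 / 2
    - n%:R * (2 / 3 * r ^+ 3))%:E.
  by congr EFin; rewrite /s /r; field; lra.
have lower gamma : admissible (@diagonal_segment R) n gamma ->
    (V <= distortion (uniform01_plane R) gamma)%E.
  move=> [gC /andP[_ gn]].
  have sgamma a : a \in gamma -> s <= a.2 - a.1.
    move=> /gC[j /= /andP[j0 jn] [_ ->]]; rewrite addrAC subrr add0r.
    by rewrite lef_pV2 ?posrE ?ltr0n// ler_nat.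
  apply: (le_trans _ (distortion_ge _ _ _ r0 (ltW s0) sgamma)).
  (* Fewer than [n] points means fewer caps to subtract, hence a larger lower bound. *)
  rewrite VE lee_fin lerD2l lerN2 ler_wpM2r ?ler_nat//.
  by rewrite mulr_ge0// exprn_ge0// ltW.
(* [u j] is the midpoint of the [j]-th cell. *)
pose u (j : nat) : R := (2 * j%:R - 1) * r.
have uE j : (optimal_point R n j).1 + (optimal_point R n j).2 = u j.
  by rewrite /u /r /=; field; lra.
have usep i j : i != j -> 2 * r <= `|u i - u j|.
  wlog ij : i j / (i < j)%N => [h|_].
    by case: (ltngtP i j) => // ij _; [|rewrite distrC];
      apply: h => //; rewrite neq_ltn ij.
  rewrite distrC; apply: le_trans (ler_norm _); rewrite /u.
  move: ij; rewrite -(ler_nat R) -addn1 natrD; nra.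
have uin j : (1 <= j <= n)%N -> r <= u j <= 1 - r.
  rewrite /u -(ler_nat R 1) -(ler_nat R j) => /andP[j0 jn].
  by apply/andP; split; nra.
have optP a : reflect (exists2 j, (1 <= j <= n)%N & a = optimal_point R n j)
    (a \in optimal_points R n).
  apply: (iffP idP) => [/imfsetP[j /=]|[j jn ->]].
    by rewrite mem_iota add1n ltnS => jn ->; exists j.
  by apply/imfsetP; exists j => //=; rewrite mem_iota add1n ltnS.
have ucov x : 0 <= x <= 1 ->
    exists2 j, (1 <= j <= n)%N & `|x - u j| <= r.
  (* Truncating [n * x] gives half-open cells, so the endpoint 1 has to be assigned to the last cell
     by hand. *)
  move=> /andP[x0 x1]; have [->|xn1] := eqVneq x 1.
    exists n; first by rewrite n_gt0 leqnn.
    by rewrite /u ler_norml; apply/andP; split; nra.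
  have nx0 : 0 <= n%:R * x by rewrite mulr_ge0// ltW.
  have /andP[k1 k2] := truncn_itv nx0; move: k1 k2.
  set k := Num.truncn _ => k1 k2.
  have kn : (k < n)%N.
    rewrite -(ltr_nat R); apply: (le_lt_trans k1).
    by rewrite -[ltRHS]mulr1 ltr_pM2l// lt_neqAle xn1.
  (* Truncation counts cells from 0, the points from 1. *)
  exists k.+1 => //.
  have -> : x = 2 * r * (n%:R * x).
    by rewrite mulrA -(mulrA 2) (mulrC r) nr mulfV// mul1r.
  move: k2; rewrite /u -natr1 => k2.
  by rewrite ler_norml; apply/andP; split; nra.
have card_opt : #|` optimal_points R n| = n.
  rewrite card_in_imfset/= ?undup_id ?size_iota ?iota_uniq// => i j _ _ ij.
  (* Distinct indices give positions [2 * r] apart, so the [n] points are distinct. *)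
  apply: contraTeq isT => /usep; rewrite -!uE ij subrr normr0; lra.
have adm : admissible (@diagonal_segment R) n (optimal_points R n).
  split; last by rewrite card_opt n_gt0 leqnn.
  move=> a /optP[j /andP[j0 jn] ->]; exists n; first by rewrite /= n_gt0 leqnn.
  split=> //; have /andP[u1 u2] := uin j (introT andP (conj j0 jn)).
  rewrite -/s; have -> : (optimal_point R n j).1 = (u j - s) / 2.
    by rewrite -uE /= -/s; field; lra.
  by apply/andP; split; lra.
have upper : (distortion (uniform01_plane R) (optimal_points R n) <= V)%E.
  rewrite VE -[in X in (_ <= X)%E]card_opt; apply: distortion_le => //.
  - by move=> a /optP[j _ ->]; rewrite /= addrC addKr.
  - by move=> a /optP[j /uin + ->]; rewrite uE.
  - move=> a b /optP[i _ ->] /optP[j _ ->] ij; rewrite !uE usep//.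
    by apply: contraNneq ij => ->.
  - move=> x /ucov[j jn xj]; exists (optimal_point R n j); last by rewrite uE.
    by apply/optP; exists j.
have dV : distortion (uniform01_plane R) (optimal_points R n) = V.
  by apply/eqP; rewrite eq_le upper lower.
have errV : constrained_quantization_error (uniform01_plane R)
    (@diagonal_segment R) n = V.
  apply/eqP; rewrite eq_le; apply/andP; split.
    by rewrite -dV; apply: ereal_inf_lbound; exists (optimal_points R n).
  by apply/ereal_infP => _ [gamma /lower + <-].
by split; [split; [|rewrite errV]|].
Qed.
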